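(* Let $D$ be a web diagram, let $W=W(D)$, and write $D=E_1\oplus E_2\oplus\cdots\oplus E_k$ where each $E_i$ is an indecomposable web diagram. Let $P=P(D)$ be the decomposition poset and $p=|P|=k$. If $E_1,\dots,E_k$ are pairwise distinct web diagrams, then $$M^{(W)}_{D,D}(x)=\sum_{\pi\in\mathcal{L}(P)}x^{1+\operatorname{des}(\pi)}(1+x)^{p-1-\operatorname{des}(\pi)} \quad\text{and}\quad R^{(W)}_{D,D}=\sum_{\pi\in\mathcal{L}(P)}\frac{(-1)^{\operatorname{des}(\pi)}}{p\binom{p-1}{\operatorname{des}(\pi)}}.$$
   Context: A web diagram on $n$ pegs with $L$ edges is a set $D=\{e_j=(x_j,y_j,a_j,b_j):1\le j\le L\}$ of $L$ distinct 4-tuples of positive integers (edge $e_j$ joins peg $x_j$ at height $a_j$ to peg $y_j$ at height $b_j$; height 1 is the bottom) such that (i) $1\le x_j<y_j\le n$, and (ii) for each peg $i$, with $p_i(D)$ the number of $j$ with $x_j=i$ or $y_j=i$, $\{b_j:y_j=i\}\cup\{a_j:x_j=i\}=\{1,\dots,p_i(D)\}$. The sum is $D\oplus D'=D\cup\{(x',y',a'+p_{x'}(D),b'+p_{y'}(D)):(x',y',a',b')\in D'\}$ ($D'$ on top of $D$); $D$ is indecomposable if it is nonempty and not of the form $E\oplus F$ with $E,F$ nonempty. For $X\subseteq D$, $\mathrm{rel}(X)$ relabels, on each peg, the heights of endpoints of edges of $X$ by $1,\dots,\ell_i$ preserving relative order. The web world $W(D)$ is the set of diagrams obtained from $D$ by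 permuting, independently on each peg $i$, the heights $1,\dots,p_i(D)$. An $\ell$-colouring of $D$ is a surjection $c:\{1,\dots,L\}\to\{1,\dots,\ell\}$; with $D_c(t)=\{e_j:c(j)=t\}$, $\mathcal{R}(D,c)=\mathrm{rel}(D_c(1))\oplus\cdots\oplus\mathrm{rel}(D_c(\ell))$. For $D_1,D_2\in W$, $f(D_1,D_2,\ell)$ is the number of $\ell$-colourings $c$ of $D_1$ with $\mathcal{R}(D_1,c)=D_2$; $M^{(W)}_{D_1,D_2}(x)=\sum_{\ell\ge1}x^\ell f(D_1,D_2,\ell)$ and $R^{(W)}_{D_1,D_2}=\sum_{\ell\ge1}\frac{(-1)^{\ell-1}}{\ell}f(D_1,D_2,\ell)$. Decomposition poset: if $D=E_1\oplus\cdots\oplus E_k$, each edge of $D$ comes from the (height-shifted) copy of exactly one summand $E_i$. $P(D)$ is the partial order on $\{E_1,\dots,E_k\}$ generated (reflexive-transitive closure) by the relations $E_i\prec E_j$ whenever $i<j$ and some edge of $D$ coming from $E_i$ has an endpoint below an endpoint of some edge of $D$ coming from $E_j$ on the same peg. A linear extension of $P$ is written as a sequence $\pi=E_{i_1}E_{i_2}\cdots E_{i_k}$ listing all elements with each element after all elements below it; $\mathcal{L}(P)$ is the set of these, and $\operatorname{des}(\pi)$ is the number of $t\in\{1,\dots,k-1\}$ with $i_t>i_{t+1}$. *)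

(* Defs.v *)
From mathcomp Require Import all_boot all_order all_algebra all_fingroup.
From mathcomp Require Import finmap.

Set Implicit Arguments.
Unset Strict Implicit.
Unset Printing Implicit Defensive.

Import GRing.Theory.
Local Open Scope fset_scope.

(* An edge is a tuple (x, y, a, b): it joins peg x at height a to peg y at
   height b.  Pegs and heights are numbered from 1. *)
Notation edge := (nat * nat * nat * nat)%type.

Definition pegx (e : edge) : nat := e.1.1.1.
Definition pegy (e : edge) : nat := e.1.1.2.
Definition hgta (e : edge) : nat := e.1.2.
Definition hgtb (e : edge) : nat := e.2.

Definition endpoints (e : edge) : seq (nat * nat) :=
  [:: (pegx e, hgta e); (pegy e, hgtb e)].

Definition peg_count (D : {fset edge}) (i : nat) : nat :=
  #|` [fset e in D | (pegx e == i) || (pegy e == i)]|.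

Definition heights (D : {fset edge}) (i : nat) : {fset nat} :=
  [fset hgtb e | e in D & pegy e == i] `|` [fset hgta e | e in D & pegx e == i].

Definition web_diagram (n : nat) (D : {fset edge}) : Prop :=
  (forall e, e \in D -> 1 <= pegx e /\ pegx e < pegy e /\ pegy e <= n) /\
  (forall i, 1 <= i <= n -> heights D i = [fset h in iota 1 (peg_count D i)]).

Definition relabel (g : nat -> nat -> nat) (e : edge) : edge :=
  (pegx e, pegy e, g (pegx e) (hgta e), g (pegy e) (hgtb e)).

(* The copy of D' that sits on top of D inside the sum of D and D'. *)
Definition wshift (D D' : {fset edge}) : {fset edge} :=
  [fset relabel (fun i h => (h + peg_count D i)%N) e | e in D'].

Definition wsum (D D' : {fset edge}) : {fset edge} := D `|` wshift D D'.

(* The empty diagram is neutral for wsum; the iterated sum nests to the right. *)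
Notation "\wsum_ ( i < k ) F" := (\big[wsum/fset0]_(i < k) F)
  (at level 41, F at level 41, i, k at level 50).
Notation "\wsum_ ( i < k | P ) F" := (\big[wsum/fset0]_(i < k | P) F)
  (at level 41, F at level 41, i, k at level 50).

Definition indecomposable (n : nat) (D : {fset edge}) : Prop :=
  D <> fset0 /\
  ~ (exists E F : {fset edge},
       web_diagram n E /\ web_diagram n F /\
       E <> fset0 /\ F <> fset0 /\ D = wsum E F).

(* The new height of an endpoint is its rank among the heights used on its peg. *)
Definition wrel (X : {fset edge}) : {fset edge} :=
  [fset relabel (fun i h => #|` [fset h' in heights X i | h' <= h]|) e | e in X].

Definition web_world (D D' : {fset edge}) : Prop :=
  exists s : nat -> nat -> nat,
    (forall i, perm_eq [seq s i h | h <- iota 1 (peg_count D i)]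
                       (iota 1 (peg_count D i))) /\
    D' = [fset relabel s e | e in D].

Lemma web_world_refl (D : {fset edge}) : web_world D D.
Proof.
exists (fun _ h => h); split=> [i|]; first by rewrite map_id.
apply/fsetP=> e; apply/idP/imfsetP=> [De|[e' De' ->]]; last first.
  by move: De' => /=; case: e' => [[[x y] a] b].
by exists e => //; case: e {De} => [[[x y] a] b].
Qed.

(* Colours 1, ..., l are encoded as 'I_l, and the edges are coloured directly
   rather than through an enumeration e_1, ..., e_L of them. *)
Definition colouring (D : {fset edge}) (l : nat) (c : {ffun D -> 'I_l}) : bool :=
  [forall t, exists e, c e == t].

Definition colour_class (D : {fset edge}) (l : nat) (c : {ffun D -> 'I_l})
  (t : 'I_l) : {fset edge} := [fset val e | e : D & c e == t].

Definition reconstruct (D : {fset edge}) (l : nat) (c : {ffun D -> 'I_l}) :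
  {fset edge} := \wsum_(t < l) wrel (colour_class c t).

Definition fcount (D1 D2 : {fset edge}) (l : nat) : nat :=
  #|[set c : {ffun D1 -> 'I_l} | colouring c && (reconstruct c == D2)]|.

Lemma fcount_eq0 (D1 D2 : {fset edge}) (l : nat) :
  #|` D1| < l -> fcount D1 D2 l = 0.
Proof.
move=> lt_D1_l; apply/eqP; rewrite cards_eq0; apply/eqP/setP=> c.
rewrite !inE; apply/negbTE/negP=> /andP[/forallP c_surj _].
have: #|'I_l| <= #|{: D1}|.
  apply: leq_trans (leq_imset_card c predT).
  rewrite -cardsT; apply/subset_leq_card/subsetP=> t _.
  by have /existsP[e /eqP <-] := c_surj t; apply: imset_f.
by rewrite card_ord -cardfE leqNgt lt_D1_l.
Qed.

Section Mixing.
Local Open Scope ring_scope.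

(* Entries of the matrices indexed by the web world of D.  The sums over all
   l >= 1 are finite: by fcount_eq0 the terms with l > #|` D1| vanish. *)
Definition webM (D : {fset edge}) (D1 D2 : {E | web_world D E}) : {poly rat} :=
  \sum_(1 <= l < (#|` sval D1|).+1) (fcount (sval D1) (sval D2) l)%:R *: 'X^l.

Definition webR (D : {fset edge}) (D1 D2 : {E | web_world D E}) : rat :=
  \sum_(1 <= l < (#|` sval D1|).+1)
    (-1) ^+ (l - 1) / l%:R * (fcount (sval D1) (sval D2) l)%:R.

End Mixing.

Definition in_own_world (D : {fset edge}) : {E | web_world D E} :=
  exist (web_world D) D (web_world_refl D).

Section DecompositionPoset.
Variables (k : nat) (E : 'I_k -> {fset edge}).

(* The edges of the sum of all the E j that come from E i. *)
Definition summand (i : 'I_k) : {fset edge} :=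
  wshift (\wsum_(j < k | j < i) E j) (E i).

Definition below (i j : 'I_k) : bool :=
  (i < j) &&
  [exists e : summand i, exists e' : summand j,
     has (fun u => has (fun v => (u.1 == v.1) && (u.2 < v.2))
                       (endpoints (val e')))
         (endpoints (val e))].

(* The order is carried by the indices, i standing for E i; connect is the
   reflexive-transitive closure. *)
Definition decomp_le : rel 'I_k := connect below.

(* s stands for the sequence E_(s 0) E_(s 1) ... E_(s (k - 1)). *)
Definition linear_ext (s : 'S_k) : bool :=
  [forall t, forall u, decomp_le (s t) (s u) ==> (t <= u)].

End DecompositionPoset.

Definition des (k : nat) (s : 'S_k) : nat :=
  #|[set t : 'I_k | [exists u : 'I_k, (u == t.+1 :> nat) && (s u < s t)]]|.

(* Main.v *)
Require Import Defs.
From mathcomp Require Import all_boot all_order all_algebra all_fingroup.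
From mathcomp Require Import finmap.
From mathcomp Require Import zify.
Import GRing.Theory.
Set Implicit Arguments.
Unset Strict Implicit.
Unset Printing Implicit Defensive.
Local Open Scope fset_scope.
Local Open Scope nat_scope.

(** Reconstructing [D] from a colouring [c] sorts the edges on every peg stably
    by colour.  If the result is [D] again, this gives a permutation [phi] of
    the edges of [D].  Since an indecomposable diagram is strongly connected
    under "has an endpoint below", the colour, and then the component index, is
    constant on the preimage under [phi] of each component.  Hence [phi]
    permutes the components and preserves their shapes; as the [E i] are
    distinct, [phi] is the identity, that is, [c] weakly increases along every
    peg.  So [fcount D D l] counts the surjective order-preserving maps from
    the decomposition poset onto a chain of [l] elements.

    Stably sorting the poset by the values of such a map gives a linear
    extension [s]; the positions where the value increases form a set of
    [l - 1] positions containing the descents of [s], and any such set occurs.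
    This gives the formula for [webM], and the one for [webR] follows from
    [\sum_j (-1)^j C(r, j) / (a + j + 1) = a! r! / (a + r + 1)!]. *)

(** * Order-preserving surjections and descents *)

(** The strict order behind a stable sort: [g] only breaks the ties of [f]. It serves for poset
    elements (value, then index) and for edges on a peg (colour, then height). *)
Definition lexlt (T : Type) (f g : T -> nat) (x y : T) : bool :=
  (f x < f y) || (f x == f y) && (g x < g y).

Lemma lexlt_trans (T : Type) (f g : T -> nat) : transitive (lexlt f g).
Proof. by move=> y x z; rewrite /lexlt; lia. Qed.

Lemma lexlt_irr (T : Type) (f g : T -> nat) x : lexlt f g x x = false.
Proof. by rewrite /lexlt; lia. Qed.

(** * Stable sorting of indices by a map *)

Section Sorting.
Variables (k : nat) (g : 'I_k -> nat).

Definition sorts (s : 'S_k) : bool :=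
  [forall t : 'I_k, forall u : 'I_k, (t < u) ==> lexlt g (@nat_of_ord k) (s t) (s u)].

(** The position, counted from 0, of [i] in the stable sort; as a function of [i] it is the inverse
    of the sorting permutation. *)
Definition sort_rank (i : 'I_k) : nat := #|[set j | lexlt g (@nat_of_ord k) j i]|.

Lemma sort_rank_lt i j : lexlt g (@nat_of_ord k) i j -> sort_rank i < sort_rank j.
Proof.
move=> ltij; apply/proper_card/properP; split.
  by apply/subsetP=> x; rewrite !inE => ltx; exact: lexlt_trans ltx ltij.
by exists i; rewrite !inE ?lexlt_irr.
Qed.

Lemma sort_rank_lt_size i : sort_rank i < k.
Proof.
rewrite -[X in _ < X]card_ord -cardsT; apply/proper_card/properP; split=> //.
by exists i; rewrite !inE ?lexlt_irr.
Qed.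

Lemma lexlt_total (i j : 'I_k) : i != j -> lexlt g (@nat_of_ord k) i j || lexlt g (@nat_of_ord k) j i.
Proof. by rewrite -val_eqE /= /lexlt; lia. Qed.

Lemma sort_rank_inj : injective sort_rank.
Proof.
move=> i j eqr; apply/eqP; apply/negPn/negP => /lexlt_total /orP[] /sort_rank_lt;
  by rewrite eqr ltnn.
Qed.

Lemma sorts_exists : exists s, sorts s.
Proof.
pose r i := Ordinal (sort_rank_lt_size i).
have r_inj : injective r by move=> i j /(congr1 val) /sort_rank_inj.
exists (perm r_inj)^-1%g; apply/forallP=> t; apply/forallP=> u; apply/implyP.
set i := ((perm r_inj)^-1%g t); set j := ((perm r_inj)^-1%g u).
have -> : t = r i by rewrite -(permE r_inj) permKV.
have -> : u = r j by rewrite -(permE r_inj) permKV.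
move=> /= ltij; have neij : i != j by apply: contraTneq ltij => ->; rewrite ltnn.
by case/orP: (lexlt_total neij) => // /sort_rank_lt; lia.
Qed.

(** The elements before [s t] are the images under [s] of the [t] positions before [t]. Hence [g]
    determines its sorting permutation. *)
Lemma sorts_rank s t : sorts s -> sort_rank (s t) = t.
Proof.
move=> /forallP ss.
have lts (u v : 'I_k) : u < v -> lexlt g (@nat_of_ord k) (s u) (s v).
  by move=> ltuv; move: (ss u) => /forallP /(_ v) /implyP; apply.
rewrite /sort_rank (_ : [set j | _] = s @: [set u : 'I_k | u < t]); last first.
  apply/setP=> j; rewrite inE; apply/idP/imsetP => [ltj|[u]]; last first.
    by rewrite inE => ltut ->; exact: lts.
  exists (s^-1 j)%g; rewrite ?permKV // inE ltnNge; apply/negP.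
  rewrite leq_eqVlt => /orP[/eqP/val_inj eqt|].
    by move: ltj; rewrite eqt permKV lexlt_irr.
  by move=> /lts; rewrite permKV => /(lexlt_trans ltj); rewrite lexlt_irr.
rewrite card_imset; last exact: perm_inj.
rewrite -sum1_card; under eq_bigl do rewrite inE.
rewrite -(big_ord_widen_cond k xpredT (fun=> 1)) ?sum1_card ?card_ord //.
exact/ltnW/ltn_ord.
Qed.

Lemma sorts_inj s s' : sorts s -> sorts s' -> s = s'.
Proof.
move=> ss ss'; apply/permP=> t; apply: sort_rank_inj.
by rewrite !sorts_rank.
Qed.

(** Existence and uniqueness of the sorting permutation, as a factor 1 to insert in a double
    count. *)
Lemma sum_sorts : \sum_(s : 'S_k | sorts s) 1 = 1.
Proof.
have [s ss] := sorts_exists; rewrite (big_pred1 s) // => s' /=.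
by apply/idP/eqP=> [ss'|->//]; exact: sorts_inj.
Qed.

End Sorting.

(** * Order-preserving surjections, split by their stable sort *)

Definition surj_map (T : finType) (l : nat) (g : T -> 'I_l) : bool :=
  [forall t, exists x, g x == t].

Definition monotone_maps (k l : nat) (le : rel 'I_k) : {set {ffun 'I_k -> 'I_l}} :=
  [set g : {ffun 'I_k -> 'I_l} | surj_map g && [forall i, forall j, le i j ==> (g i <= g j)]].

Definition sorted_maps (k l : nat) (s : 'S_k) : {set {ffun 'I_k -> 'I_l}} :=
  [set g : {ffun 'I_k -> 'I_l} | surj_map g && sorts (fun i => g i) s].

(** Each [g] is counted at its stable sort [s]. If [s] is a linear extension, [g] weakly increases
    along it and so respects [le]; conversely, the sort of a monotone [g] is a linear extension,
    because [le] agrees with the index order that breaks ties. *)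
Lemma card_monotone_maps (k l : nat) (le : rel 'I_k) :
  (forall i j, le i j -> i <= j) ->
  #|monotone_maps l le| =
  \sum_(s : 'S_k | [forall t, forall u, le (s t) (s u) ==> (t <= u)])
     #|sorted_maps l s|.
Proof.
move=> le_leq; rewrite -sum1_card.
under eq_bigr => g _ do rewrite -(sum_sorts (fun i => g i)).
rewrite (exchange_big_dep xpredT) //= [RHS]big_mkcond /=; apply: eq_bigr => s _.
rewrite sum1dep_card.
have ltP (g : {ffun 'I_k -> 'I_l}) : sorts (fun i => g i) s ->
    forall t u : 'I_k, t < u -> lexlt (fun i => val (g i)) (@nat_of_ord _) (s t) (s u).
  by move=> /forallP ss t u; move: (ss t) => /forallP /(_ u) /implyP.
case: ifP => [/forallP LE|/negbT]; last first.
  move=> nLE; apply/eqP; rewrite cards_eq0; apply/eqP/setP=> g; rewrite !inE.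
  apply/negbTE; apply: contra nLE => /andP[/andP[_ /forallP mon] /ltP ss].
  apply/forallP=> t; apply/forallP=> u; apply/implyP=> letu.
  rewrite leqNgt; apply/negP => /ss; rewrite /lexlt.
  move: (mon (s t)) => /forallP /(_ (s u)) /implyP /(_ letu).
  by move: (le_leq _ _ letu) => /=; lia.
apply: eq_card => g; rewrite !inE; apply/andP/andP=> [[/andP[-> _] ->]//|[sg ss]].
split=> //; rewrite sg /=; apply/forallP=> i; apply/forallP=> j; apply/implyP.
rewrite -(permKV s i) -(permKV s j); set t := (s^-1%g i); set u := (s^-1%g j).
move=> letu; move: (LE t) => /forallP /(_ u) /implyP /(_ letu).
rewrite leq_eqVlt => /orP[/eqP/val_inj->//|/(ltP _ ss)].
by rewrite /lexlt /=; lia.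
Qed.

(** * Surjections with a given stable sort, encoded by ascent sets *)

Section CountSorted.
Variables (m : nat) (s : 'S_m.+1).

(** Taken in ['I_m], the gaps between consecutive positions, for comparison with [ascents]. Since
    [j.+1 <= m], both uses of [inord] are exact. *)
Definition descents : {set 'I_m} := [set j : 'I_m | s (inord j.+1) < s (inord j)].

Lemma card_descents : #|descents| = des s.
Proof.
have inj : injective (fun j : 'I_m => inord j : 'I_m.+1).
  move=> i j /(congr1 val) /=; rewrite !inordK; last 2 first.
  - by have := ltn_ord j; lia.
  - by have := ltn_ord i; lia.
  exact: val_inj.
rewrite -(card_imset _ inj) /des; apply: eq_card => t; rewrite !inE.
apply/imsetP/existsP=> [[j]|[u /andP[/eqP equ ltu]]].
  rewrite inE => ltj ->; exists (inord j.+1).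
  by rewrite !inordK ?ltj ?andbT //; have := ltn_ord j; lia.
have ltm : t < m by have := ltn_ord u; rewrite equ.
exists (Ordinal ltm); last by rewrite inord_val.
rewrite inE /=; have -> : inord t.+1 = u :> 'I_m.+1 by apply/val_inj; rewrite /= -equ inordK.
by rewrite inord_val.
Qed.

(** When [T] is the ascent set of a map sorted by [s], this is the value of the map at position
    [t]. *)
Definition count_below (T : {set 'I_m}) (t : nat) : nat := #|[set j in T | j < t]|.

Lemma count_below0 T : count_below T 0 = 0.
Proof. by apply/eqP; rewrite cards_eq0; apply/eqP/setP=> j; rewrite !inE andbF. Qed.

Lemma count_below_all T t : m <= t -> count_below T t = #|T|.
Proof.
move=> lemt; apply: eq_card => j; rewrite !inE andb_idr // => _.
by have := ltn_ord j; lia.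
Qed.

Lemma count_belowS T t (ltm : t < m) :
  count_below T t.+1 = count_below T t + (Ordinal ltm \in T).
Proof.
rewrite /count_below (cardsD1 (Ordinal ltm)) !inE /= ltnS leqnn andbT addnC.
congr (_ + _); apply: eq_card => j; rewrite !inE -val_eqE /= ltnS.
by rewrite (ltn_neqAle j) andbCA.
Qed.

Variable l : nat.

Definition ascents (g : {ffun 'I_m.+1 -> 'I_l.+1}) : {set 'I_m} :=
  [set j : 'I_m | g (s (inord j)) < g (s (inord j.+1))].

(** Along [s] the values weakly increase, and surjectivity lets them skip nothing: they start at 0
    and grow by exactly 1 at each ascent. So the ascents determine [g]. *)
Lemma sorted_mapsE g : g \in sorted_maps l.+1 s ->
  forall t, t <= m -> g (s (inord t)) = count_below (ascents g) t :> nat.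
Proof.
rewrite inE => /andP[/forallP sg /forallP ss].
have mon t u : t <= u -> u <= m -> g (s (inord t)) <= g (s (inord u)).
  rewrite leq_eqVlt => /orP[/eqP->//|lttu leum].
  move: (ss (inord t)) => /forallP /(_ (inord u)) /implyP.
  by rewrite !inordK /lexlt /=; [move=> /(_ lttu); lia|lia|lia].
have hit v : v <= l -> exists2 u, u <= m & g (s (inord u)) = v :> nat.
  move=> lev; have /existsP[x /eqP gx] := sg (inord v).
  exists (s^-1 x)%g; first by have := ltn_ord (s^-1 x)%g.
  by rewrite inord_val permKV gx inordK.
elim=> [|t IH] ltm.
  rewrite count_below0; have [u leu gu] := hit 0 isT.
  by have := mon 0 u isT leu; lia.
rewrite (count_belowS _ ltm) -(IH (ltnW ltm)) inE /=.
have := mon t t.+1 (leqnSn t) ltm.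
case: ltnP => /= [lt1 _|]; last lia.
have lel : g (s (inord t.+1)) <= l by rewrite -ltnS.
(* The next value is attained at some position [u]; monotonicity puts [u] after [t], so the jump at
   [t] cannot exceed 1. *)
have [u leu gu] := hit (g (s (inord t))).+1 (leq_trans lt1 lel).
case: (leqP u t) => [leut|ltut].
  by have := mon u t leut (ltnW ltm); lia.
apply/eqP; rewrite eqn_leq addn1 lt1 andbT -gu; exact: mon.
Qed.

Lemma ascents_inj : {in sorted_maps l.+1 s &, injective ascents}.
Proof.
move=> g g' gs gs' eqa; apply/ffunP=> x; rewrite -(permKV s x) -(inord_val (s^-1%g x)).
by apply/val_inj; rewrite /= !sorted_mapsE ?eqa // -ltnS.
Qed.

(** At a descent a tie would violate stability, so the value rises there; the number of ascents is
    the last value, [l]. Conversely, [count_below T] yields a map with ascent set [T]. *)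
Lemma ascents_sorted_maps :
  ascents @: sorted_maps l.+1 s = [set T : {set 'I_m} | (descents \subset T) && (#|T| == l)].
Proof.
apply/setP=> T; rewrite inE; apply/imsetP/andP=> [[g gs ->]|[sub /eqP cardT]].
  split.
    apply/subsetP=> j; rewrite !inE => ltj; have ltjm := ltn_ord j.
    move: gs; rewrite inE => /andP[_ /forallP /(_ (inord j)) /forallP].
    move=> /(_ (inord j.+1)) /implyP; rewrite !inordK ?ltnS //; last exact: ltnW.
    by move=> /(_ (leqnn _)); rewrite /lexlt /=; lia.
  rewrite -(@count_below_all _ m) // -sorted_mapsE //.
  move: (gs); rewrite inE => /andP[/forallP /(_ ord_max) /existsP[x /eqP gx] _].
  rewrite eqn_leq -ltnS ltn_ord /=.
  have lex : s^-1%g x <= m by rewrite -ltnS ltn_ord.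
  have := sorted_mapsE gs lex.
  rewrite inord_val permKV gx /= => /eq_leq/leq_trans; apply.
  rewrite (sorted_mapsE gs) //  (@count_below_all _ m) //.
  by apply/subset_leq_card/subsetP=> j; rewrite inE => /andP[].
have leT t : count_below T t <= l.
  by rewrite -cardT; apply/subset_leq_card/subsetP=> j; rewrite inE => /andP[].
pose g := [ffun x => inord (count_below T (s^-1 x)%g)] : {ffun 'I_m.+1 -> 'I_l.+1}.
have gE t : t <= m -> g (s (inord t)) = count_below T t :> nat.
  by move=> le_tm; rewrite ffunE permK !inordK ?ltnS.
exists g; last first.
  apply/setP=> j; have ltj := ltn_ord j; rewrite inE !gE //; last exact: ltnW.
  rewrite (count_belowS _ ltj) (_ : Ordinal ltj = j); last exact: val_inj.
  by case: (j \in T); rewrite ?addn0 ?addn1 ?ltnn ?ltnSn.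
rewrite inE; apply/andP; split.
  (* A discrete intermediate value argument: [count_below T] starts at 0 and grows by at most 1 per
     step. *)
  have hit v t : v <= count_below T t -> t <= m ->
      exists2 u, u <= m & count_below T u = v.
    elim: t => [|t IH] lev letm.
      by exists 0; rewrite ?count_below0 //; move: lev; rewrite count_below0; lia.
    have [|ltv] := leqP v (count_below T t); first by move/IH; apply; exact: ltnW.
    exists t.+1 => //; move: lev; rewrite (count_belowS _ letm).
    by case: (_ \in T) => /=; lia.
  apply/forallP=> v; have [||u leum cu] := hit v m _ _; first 2 last.
  - by apply/existsP; exists (s (inord u)); apply/eqP/val_inj; rewrite /= gE.
  - by rewrite count_below_all // cardT -ltnS.
  - by [].
have step t : t < m -> lexlt (fun i => val (g i)) (@nat_of_ord _) (s (inord t)) (s (inord t.+1)).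
  move=> ltm; rewrite /lexlt /= !gE // ?(ltnW ltm) // (count_belowS _ ltm).
  case: (boolP (_ \in T)) => [|nT] /=; first by lia.
  (* At a gap outside [T] the values tie; as it is no descent, the indices increase, as stability
     demands. *)
  have : Ordinal ltm \notin descents by apply: contra nT; apply/subsetP.
  rewrite inE /= -leqNgt addn0 eqxx ltnn /= leq_eqVlt => /orP[/eqP/val_inj/perm_inj|//].
  by move/(congr1 val); rewrite /= !inordK; lia.
have all t u : t < u -> u <= m -> lexlt (fun i => val (g i)) (@nat_of_ord _) (s (inord t)) (s (inord u)).
  elim: u => // u IH; rewrite ltnS leq_eqVlt => /orP[/eqP->|ltu] leum; first exact: step.
  exact: lexlt_trans (IH ltu (ltnW leum)) (step _ leum).
apply/forallP=> t; apply/forallP=> u; apply/implyP=> ltu.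
by have := all t u ltu; rewrite !inord_val; apply; rewrite -ltnS.
Qed.

End CountSorted.

(** Complementation turns the [l]-sets containing all descents into the [(m - l)]-sets of
    non-descents. The case [m < l] is separate because truncated subtraction would make the binomial
    1. *)
Lemma card_sorted_maps (m l : nat) (s : 'S_m.+1) :
  #|sorted_maps l.+1 s| = if l <= m then 'C(m - des s, m - l) else 0.
Proof.
rewrite -(card_in_imset (@ascents_inj m s l)) ascents_sorted_maps.
case: ifP => [lelm|/negbT nle]; last first.
  apply/eqP; rewrite cards_eq0; apply/eqP/setP=> T; rewrite !inE.
  apply/negbTE/negP=> /andP[_ /eqP eqT]; have := max_card (mem T).
  by rewrite card_ord eqT; lia.
have -> : m - des s = #|~: descents s|.
  by rewrite cardsCs setCK card_ord card_descents.
rewrite -cards_draws.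
rewrite -(card_imset _ (@setC_inj 'I_m)); apply: eq_card => U.
rewrite [RHS]inE; apply/imsetP/andP => [[T]|[sub /eqP cardU]].
  rewrite inE => /andP[sub /eqP cardT] ->; rewrite setCS; split=> //.
  by rewrite cardsCs setCK card_ord cardT.
exists (~: U); last by rewrite setCK.
by rewrite inE -setCS setCK sub /= cardsCs setCK card_ord cardU subKn.
Qed.

Lemma des_le (m : nat) (s : 'S_m.+1) : des s <= m.
Proof. by rewrite -card_descents -[X in _ <= X]card_ord max_card. Qed.

(** * Binomial sums *)

Section RingSums.
Local Open Scope ring_scope.

(** The binomial vanishes for [l < d]; the rest is reindexed by [l = d + j] and the symmetry of
    binomials. *)
Lemma sum_bin_shift (V : nmodType) (m d : nat) (w : nat -> V) : (d <= m)%N ->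
  \sum_(0 <= l < m.+1) w l *+ 'C(m - d, m - l) =
  \sum_(0 <= j < (m - d).+1) w (d + j)%N *+ 'C(m - d, j).
Proof.
move=> led; rewrite (big_cat_nat (n := d)) //=; last exact: leqW.
rewrite big_nat big1 ?add0r => [|l /andP[_ ltl]]; last first.
  by rewrite bin_small ?mulr0n //; lia.
rewrite -{1}[d]add0n big_addn subSn // !big_mkord; apply: eq_bigr => j _.
rewrite addnC -[in RHS]bin_sub; last by have := ltn_ord j; lia.
by congr (_ *+ 'C(_, _)); lia.
Qed.

(** Both sides are the Beta integral of [t^a (1 - t)^r] over the unit interval; the proof is an
    induction on [r]. *)
Lemma alternating_bin_sum (a r : nat) :
  \sum_(0 <= j < r.+1) ((-1) ^+ j / (a + j).+1%:R) *+ 'C(r, j) =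
  (a`! * r`!)%:R / ((a + r).+1)`!%:R :> rat.
Proof.
have fact_neq0 n : (n`!%:R != 0 :> rat)%R by rewrite Num.Theory.pnatr_eq0 -lt0n fact_gt0.
have nat_neq0 n : (n.+1%:R != 0 :> rat)%R by rewrite Num.Theory.pnatr_eq0.
elim: r a => [|r IH] a.
  rewrite big_nat1 bin0 mulr1n expr0 addn0 factS fact0 muln1 natrM.
  by rewrite invfM mulrCA divff // mulr1 div1r.
(* Pascal's rule writes the sum for [r.+1] as the difference of the sums for [r] at [a] and at
   [a.+1]. *)
have -> : \sum_(0 <= j < r.+2) ((-1) ^+ j / (a + j).+1%:R) *+ 'C(r.+1, j) =
    \sum_(0 <= j < r.+1) ((-1) ^+ j / (a + j).+1%:R) *+ 'C(r, j) -
    \sum_(0 <= j < r.+1) ((-1) ^+ j / (a.+1 + j).+1%:R) *+ 'C(r, j) :> rat.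
  rewrite big_nat_recl // bin0 /=.
  under eq_bigr do rewrite binS mulrnDr.
  rewrite big_split /= addrA; congr (_ + _).
    rewrite [in RHS]big_nat_recl // bin0; congr (_ + _).
    by rewrite big_nat_recr //= bin_small // mulr0n addr0.
  rewrite -sumrN; apply: eq_bigr => j _.
  by rewrite exprS mulN1r mulNr mulNrn addSnnS.
rewrite !IH addSnnS !addnS.
have factSr n : n.+1`!%:R = n.+1%:R * n`!%:R :> rat by rewrite factS natrM.
rewrite (natrM _ a`! r`!) (natrM _ (a.+1)`! r`!) (natrM _ a`! (r.+1)`!).
rewrite (factSr (a + r).+1) (factSr a) (factSr r).
set F := (((a + r).+1)`!%:R : rat); set A := (a`!%:R : rat).
set B := (r`!%:R : rat).
(* Over the common denominator [(a + r + 2)!] the claim reduces to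
   [(a + r + 2) - (a + 1) = r + 1]. *)
have -> : A * B / F = (a + r).+2%:R * (A * B) / ((a + r).+2%:R * F) :> rat.
  by rewrite -mulf_div divff // mul1r.
rewrite -mulrBl; congr (_ / _).
have -> : (a + r).+2%:R = a.+1%:R + r.+1%:R :> rat by rewrite -natrD; congr _%:R; lia.
by rewrite -!mulrA mulrDl addrAC subrr add0r mulrCA.
Qed.

(** The weight [w] is arbitrary, so one rearrangement serves both the polynomial and the rational
    formula. Any bound [L > m] will do, as [m.+1] elements cannot cover a longer chain. *)
Lemma sum_monotone_maps (V : nmodType) (m L : nat) (le : rel 'I_m.+1) (w : nat -> V) :
  (m < L)%N -> (forall i j, le i j -> (i <= j)%N) ->
  \sum_(1 <= l < L.+1) w l *+ #|monotone_maps l le| =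
  \sum_(s : 'S_m.+1 | [forall t, forall u, le (s t) (s u) ==> (t <= u)%N])
     \sum_(0 <= j < (m - des s).+1) w (des s + j).+1 *+ 'C(m - des s, j).
Proof.
move=> ltmL le_leq.
under [LHS]eq_bigr => l _ do rewrite card_monotone_maps // -sumrMnr.
rewrite exchange_big; apply: eq_bigr => s _.
rewrite big_add1 /= -(sum_bin_shift (fun l => w l.+1) (des_le s)).
rewrite (big_cat_nat (n := m.+1)) //= [X in _ + X]big_nat [X in _ + X]big1 ?addr0.
  rewrite !big_mkord; apply: eq_bigr => l _.
  by rewrite card_sorted_maps -ltnS ltn_ord.
by move=> l /andP[ltl _]; rewrite card_sorted_maps leqNgt ltl mulr0n.
Qed.

Lemma sum_polyX_bin (d r : nat) :
  \sum_(0 <= j < r.+1) 'X^((d + j).+1) *+ 'C(r, j) =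
  'X^(1 + d) * (1 + 'X) ^+ r :> {poly rat}.
Proof.
rewrite exprDn big_distrr big_mkord; apply: eq_bigr => j _ /=.
by rewrite expr1n mul1r mulrnAr -exprD.
Qed.

Lemma sum_alternating_inv_bin (d r : nat) :
  \sum_(0 <= j < r.+1) ((-1) ^+ ((d + j).+1 - 1) / (d + j).+1%:R) *+ 'C(r, j) =
  (-1) ^+ d / ((d + r).+1%:R * 'C(d + r, d)%:R) :> rat.
Proof.
have fact_neq0 n : n`!%:R != 0 :> rat by rewrite Num.Theory.pnatr_eq0 -lt0n fact_gt0.
transitivity ((-1) ^+ d * ((d`! * r`!)%:R / ((d + r).+1)`!%:R) : rat).
  rewrite -alternating_bin_sum big_distrr; apply: eq_bigr => j _ /=.
  by rewrite subn1 /= exprD -mulrA mulrnAr.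
congr (_ * _); have bf := bin_fact (leq_addr r d); rewrite addKn in bf.
have nz : (d`! * r`!)%:R != 0 :> rat by rewrite natrM mulf_neq0.
rewrite factS; move: (d`! * r`!)%N ((d + r)`!) bf nz => q _ <- nz.
by rewrite mulnA !natrM invfM mulrCA divff ?mulr1.
Qed.

End RingSums.

(** * Web diagrams and their sums *)

Definition touch (i : nat) (e : edge) : bool := (pegx e == i) || (pegy e == i).

(** Meaningful only under [touch i e]; elsewhere the default is [hgtb e]. *)
Definition hgt (i : nat) (e : edge) : nat := if pegx e == i then hgta e else hgtb e.

Definition on_peg (D : {fset edge}) (i : nat) : {fset edge} :=
  [fset e in D | touch i e].

Definition loopless (D : {fset edge}) : Prop :=
  forall e, e \in D -> pegx e != pegy e.

Lemma in_fset_sep (K : choiceType) (A : {fset K}) (P : pred K) x :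
  (x \in [fset y in A | P y]) = (x \in A) && P x.
Proof. by rewrite inE. Qed.

Lemma in_fset_iota (h m : nat) : (h \in [fset x in iota 1 m]) = (0 < h <= m).
Proof. by rewrite !inE mem_iota; lia. Qed.

Lemma touchx e : touch (pegx e) e. Proof. by rewrite /touch eqxx. Qed.
Lemma touchy e : touch (pegy e) e. Proof. by rewrite /touch eqxx orbT. Qed.

Lemma hgtx e : hgt (pegx e) e = hgta e. Proof. by rewrite /hgt eqxx. Qed.
Lemma hgty e : pegx e != pegy e -> hgt (pegy e) e = hgtb e.
Proof. by rewrite /hgt => /negbTE->. Qed.

Lemma edge_eq e e' : pegx e != pegy e -> pegx e = pegx e' -> pegy e = pegy e' ->
  (forall i, touch i e -> hgt i e = hgt i e') -> e = e'.
Proof.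
move=> ne eqx eqy eqh; have := eqh _ (touchx e); have := eqh _ (touchy e).
rewrite hgtx hgty // eqx eqy hgtx hgty -?eqx -?eqy //.
by case: e e' eqx eqy {ne eqh} => [[[x y] a] b] [[[x' y'] a'] b'];
  rewrite /pegx /pegy /hgta /hgtb /= => -> -> -> ->.
Qed.

Lemma endpointsP e i h : pegx e != pegy e ->
  ((i, h) \in endpoints e) = touch i e && (hgt i e == h).
Proof.
move=> ne; rewrite /endpoints /touch /hgt !inE !xpair_eqE ![i == _]eq_sym ![h == _]eq_sym.
case: (altP (pegx e =P i)) => [eqi|_] //=.
by rewrite -eqi [pegy e == _]eq_sym (negbTE ne) orbF.
Qed.

Lemma heightsP D i h : loopless D ->
  reflect (exists2 e, e \in on_peg D i & hgt i e = h) (h \in heights D i).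
Proof.
move=> ll; rewrite inE; apply: (iffP orP) => [[]|[e]].
- move=> /imfsetP[e /=]; rewrite inE => /andP[De /eqP yi] ->.
  exists e; first by rewrite !inE /= De -yi touchy.
  by rewrite -yi hgty ?ll.
- move=> /imfsetP[e /=]; rewrite inE => /andP[De /eqP xi] ->.
  exists e; first by rewrite !inE /= De -xi touchx.
  by rewrite -xi hgtx.
rewrite !inE /= => /andP[De te] <-; move: te; rewrite /touch /hgt.
case: eqP => [xi _|_ yi]; [right|left]; apply/imfsetP; exists e => //=; rewrite inE De //.
by rewrite xi eqxx.
Qed.

Lemma heightsE D i : loopless D -> heights D i = hgt i @` on_peg D i.
Proof.
move=> ll; apply/fsetP=> h; apply/heightsP/imfsetP => //= -[e De eh]; exists e => //.
Qed.

Lemma peg_countE D i : peg_count D i = #|` on_peg D i|. Proof. by []. Qed.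

Lemma touch_relabel i g e : touch i (relabel g e) = touch i e. Proof. by []. Qed.

Lemma hgt_relabel i g e : touch i e -> hgt i (relabel g e) = g i (hgt i e).
Proof.
rewrite /touch /hgt [pegx (relabel _ _)]/(pegx e).
by case: eqP => [<-|_ /= /eqP<-].
Qed.

Lemma relabel_comp g g' e :
  relabel g (relabel g' e) = relabel (fun i h => g i (g' i h)) e.
Proof. by []. Qed.

Lemma eq_relabel g g' e : (forall i h, g i h = g' i h) -> relabel g e = relabel g' e.
Proof. by move=> eqg; rewrite /relabel !eqg. Qed.

Lemma relabel_id g e : pegx e != pegy e ->
  (forall i, touch i e -> g i (hgt i e) = hgt i e) -> relabel g e = e.
Proof.
move=> ne gid; apply: edge_eq => // i te.
by rewrite hgt_relabel // gid.
Qed.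

Lemma relabel_inj_in (X : {fset edge}) g :
  (forall i, {in heights X i &, injective (g i)}) -> {in X &, injective (relabel g)}.
Proof.
move=> ginj e e' Xe Xe' [] eqx eqy.
have hx f : f \in X -> hgta f \in heights X (pegx f).
  move=> Xf; rewrite inE; apply/orP; right; apply/imfsetP; exists f => //=.
  by rewrite inE Xf eqxx.
have hy f : f \in X -> hgtb f \in heights X (pegy f).
  move=> Xf; rewrite inE; apply/orP; left; apply/imfsetP; exists f => //=.
  by rewrite inE Xf eqxx.
rewrite eqx eqy => /ginj eqa /ginj eqb.
move: eqa eqb; rewrite -{1}eqx -{1}eqy !hx // !hy // => /(_ isT isT) + /(_ isT isT).
case: e e' eqx eqy {Xe Xe'} => [[[x y] a] b] [[[x' y'] a'] b'].
by rewrite /pegx /pegy /hgta /hgtb /= => -> -> -> ->.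
Qed.

Lemma peg_count_relabel (X : {fset edge}) g i : {in X &, injective (relabel g)} ->
  peg_count [fset relabel g e | e in X] i = peg_count X i.
Proof.
move=> ginj; rewrite !peg_countE.
have -> : on_peg [fset relabel g e | e in X] i = relabel g @` on_peg X i.
  apply/fsetP=> e; rewrite !inE /=; apply/andP/imfsetP.
    move=> [/imfsetP[f /= Xf ->]]; rewrite touch_relabel => tf.
    by exists f => //=; rewrite !inE /= Xf.
  move=> [f /=]; rewrite !inE /= => /andP[Xf tf] ->; rewrite touch_relabel tf.
  by split=> //; apply/imfsetP; exists f.
rewrite card_in_imfset //= => e e'; rewrite !inE /= => /andP[Xe _] /andP[Xe' _].
exact: ginj.
Qed.

(** Web diagrams with the bound on the pegs forgotten: the height condition holds at every peg, so
    sums need no side condition. *)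
Definition flat (D : {fset edge}) : Prop :=
  loopless D /\ forall i, heights D i = [fset h in iota 1 (peg_count D i)].

Lemma web_diagram_flat n D : web_diagram n D -> flat D.
Proof.
move=> [pegs hts]; have ll : loopless D by move=> e /pegs; lia.
split=> // i; have [/hts//|out] := boolP (1 <= i <= n).
have none : on_peg D i = fset0.
  apply/fsetP=> e; rewrite !inE /=; apply/negbTE/negP => /andP[/pegs].
  by rewrite /touch; lia.
by rewrite heightsE // peg_countE none cardfs0 imfset0; apply/fsetP=> h; rewrite !inE.
Qed.

Section Flat.
Variables (D : {fset edge}) (flatD : flat D).

(** A peg carries as many heights as edges, so no height repeats. *)
Lemma flat_hgt_inj i : {in on_peg D i &, injective (hgt i)}.
Proof.
have [ll hts] := flatD; apply/card_in_imfsetP; rewrite -heightsE // hts -peg_countE.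
rewrite card_fseq undup_id ?size_iota //; exact: iota_uniq.
Qed.

Lemma flat_bound i e : e \in on_peg D i -> 0 < hgt i e <= peg_count D i.
Proof.
have [ll hts] := flatD => De.
have : hgt i e \in heights D i by apply/heightsP => //; exists e.
by rewrite hts !inE mem_iota; lia.
Qed.

Lemma flat_onto i h : 0 < h <= peg_count D i -> exists2 e, e \in on_peg D i & hgt i e = h.
Proof.
have [ll hts] := flatD => hb; apply/heightsP => //.
by rewrite hts !inE mem_iota; lia.
Qed.

(** The edges at or below [e] take each of the heights [1] to [hgt i e] once. Heights become
    cardinals, comparable with the ranks of a sort. *)
Lemma flat_rank i e : e \in on_peg D i ->
  #|` [fset e' in on_peg D i | hgt i e' <= hgt i e]| = hgt i e.
Proof.
move=> De; have := flat_bound De => /andP[_ leh].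
have injh : {in [fset e' in on_peg D i | hgt i e' <= hgt i e] &, injective (hgt i)}.
  move=> f f'; rewrite !inE /= => /andP[Df _] /andP[Df' _].
  by apply: flat_hgt_inj; rewrite !inE.
have /card_in_imfsetP/eqP <- := injh.
have -> : [fset hgt i x | x in [fset e' in on_peg D i | hgt i e' <= hgt i e]] =
          [fset h in iota 1 (hgt i e)].
  apply/fsetP=> h; rewrite !inE mem_iota /=; apply/imfsetP/idP => /=.
    move=> [f]; rewrite inE /= => /andP[Df le_f] ->.
    by have := flat_bound Df; lia.
  move=> hb; have [|f Df fh] := @flat_onto i h; first lia.
  by exists f => //=; move: (Df); rewrite !inE /= => ->; rewrite fh; lia.
by rewrite card_fseq undup_id ?size_iota //; exact: iota_uniq.
Qed.

End Flat.

(** * Sums of diagrams *)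

Lemma relabel_shift_inj (o : nat -> nat) :
  injective (relabel (fun i h => h + o i)).
Proof.
move=> [[[x y] a] b] [[[x' y'] a'] b'] [].
by rewrite /pegx /pegy /hgta /hgtb /= => -> -> /addIn-> /addIn->.
Qed.

Lemma flat0 : flat fset0.
Proof.
split=> // i; rewrite heightsE // peg_countE.
have -> : on_peg fset0 i = fset0 by apply/fsetP=> e; rewrite !inE.
by rewrite cardfs0 imfset0; apply/fsetP=> h; rewrite !inE.
Qed.

Lemma peg_count0 i : peg_count fset0 i = 0.
Proof. by apply/eqP; rewrite cardfs_eq0; apply/eqP/fsetP=> e; rewrite !inE. Qed.

Section FlatSum.
Variables (D D' : {fset edge}) (flatD : flat D) (flatD' : flat D').

Lemma on_peg_wsum i : on_peg (wsum D D') i =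
  on_peg D i `|` relabel (fun i h => h + peg_count D i) @` on_peg D' i.
Proof.
apply/fsetP=> e; rewrite !inE /= andb_orl; congr (_ || _).
apply/andP/imfsetP.
  move=> [/imfsetP[f /= Xf ->]]; rewrite touch_relabel => tf.
  by exists f => //=; rewrite !inE /= Xf.
move=> [f /=]; rewrite !inE /= => /andP[Xf tf] ->; rewrite touch_relabel tf.
by split=> //; apply/imfsetP; exists f.
Qed.

Lemma peg_count_wsum i : peg_count (wsum D D') i = peg_count D i + peg_count D' i.
Proof.
rewrite !peg_countE on_peg_wsum cardfsU.
(* On peg [i] the heights of [D] are at most [peg_count D i], and the shifted ones exceed it. *)
have -> : on_peg D i `&` relabel (fun i h => h + peg_count D i) @` on_peg D' i = fset0.
  apply/fsetP=> e; rewrite in_fsetI in_fset0; apply/negbTE/negP=> /andP[De].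
  move=> /imfsetP[f /= Df ef]; have /andP[_ tf] : (f \in D') && touch i f.
    by move: Df; rewrite !inE.
  have := flat_bound flatD De; have := flat_bound flatD' Df.
  by rewrite ef hgt_relabel //; lia.
by rewrite cardfs0 subn0; congr (_ + _); rewrite (card_imfset _ _ (@relabel_shift_inj (peg_count D))).
Qed.

Lemma flat_wsum : flat (wsum D D').
Proof.
have [[ll hts] [ll' hts']] := (flatD, flatD').
have llw : loopless (wsum D D').
  by move=> e; rewrite inE => /orP[/ll//|/imfsetP[f /= /ll' Df ->]].
split=> // i; rewrite heightsE // peg_count_wsum on_peg_wsum.
apply/fsetP=> h; rewrite !inE mem_iota; apply/imfsetP/idP => /= [[e]|hb].
  rewrite in_fsetU => /orP[De ->|/imfsetP[f /= Df ->]].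
    by have := flat_bound flatD De; lia.
  have tf : touch i f by move: Df; rewrite !inE => /andP[].
  by move=> ->; rewrite hgt_relabel //; have := flat_bound flatD' Df; lia.
case: (leqP h (peg_count D i)) => [leh|lth].
  have [|e De eh] := @flat_onto _ flatD i h; first lia.
  by exists e => //; rewrite in_fsetU De.
have [|f Df fh] := @flat_onto _ flatD' i (h - peg_count D i); first lia.
have tf : touch i f by move: Df; rewrite !inE => /andP[].
exists (relabel (fun i h => h + peg_count D i) f); last by rewrite hgt_relabel //; lia.
by rewrite in_fsetU; apply/orP; right; apply/imfsetP; exists f.
Qed.

End FlatSum.

Lemma big_wsum_flat (I : Type) (r : seq I) (P : pred I) (F : I -> {fset edge}) :
  (forall i, flat (F i)) ->
  flat (\big[wsum/fset0]_(i <- r | P i) F i) /\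
  forall p, peg_count (\big[wsum/fset0]_(i <- r | P i) F i) p =
            \sum_(i <- r | P i) peg_count (F i) p.
Proof.
move=> flatF; elim: r => [|i r [IH1 IH2]].
  rewrite !big_nil; split; first exact: flat0.
  by move=> p; rewrite big_nil peg_count0.
rewrite !big_cons; case: ifP => Pi; last first.
  by split=> // p; rewrite big_cons Pi.
split; first exact: flat_wsum.
by move=> p; rewrite big_cons Pi peg_count_wsum // IH2.
Qed.

(** As the sum nests to the right, an edge is shifted once for each earlier summand, and these
    shifts add up. *)
Lemma in_big_wsum (l : nat) (F : 'I_l -> {fset edge}) (e : edge) :
  e \in \wsum_(t < l) F t <->
  exists t : 'I_l, exists2 f, f \in F t &
    e = relabel (fun i h => h + \sum_(u < l | u < t) peg_count (F u) i) f.
Proof.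
elim: l F e => [|l IH] F e.
  by rewrite big_ord0 inE; split=> // -[[]].
have sumS (t : 'I_l) i : \sum_(u < l.+1 | u < lift ord0 t) peg_count (F u) i =
    \sum_(u < l | u < t) peg_count (F (lift ord0 u)) i + peg_count (F ord0) i.
  by rewrite big_mkcond big_ord_recl /= addnC [in RHS]big_mkcond.
rewrite big_ord_recl /wsum inE; split.
  case/orP=> [eF|/imfsetP[e1 /= /IH[t [f Ff ->]] ->]].
    exists ord0, e => //; rewrite /relabel big_pred0 // big_pred0 //.
    by case: e eF => [[[x y] a] b] _; rewrite /pegx /pegy /hgta /hgtb /= !addn0.
  exists (lift ord0 t), f => //; rewrite relabel_comp; apply: eq_relabel => i h.
  by rewrite sumS addnA.
move=> [t [f]]; case: (unliftP ord0 t) => [t' ->|->] Ff ->; apply/orP; last first.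
  left; rewrite (_ : relabel _ f = f) // /relabel big_pred0 // big_pred0 //.
  by case: f Ff => [[[x y] a] b] _; rewrite /pegx /pegy /hgta /hgtb /= !addn0.
right; apply/imfsetP => /=.
exists (relabel (fun i h => h + \sum_(u < l | u < t') peg_count (F (lift ord0 u)) i) f).
  by apply/IH; exists t', f.
by rewrite relabel_comp; apply: eq_relabel => i h; rewrite sumS addnA.
Qed.

(* A nonempty proper subset of the edges that is closed under going down along
   the pegs would split E into a sum. *)
Lemma indecomposable_ind (n : nat) (E : {fset edge}) (P : pred edge) :
  web_diagram n E -> indecomposable n E ->
  (exists2 e, e \in E & P e) ->
  (forall i e e', e \in on_peg E i -> e' \in on_peg E i ->
     hgt i e < hgt i e' -> P e' -> P e) ->
  forall e, e \in E -> P e.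
Proof.
move=> webE [_ indec] [e0 Ee0 Pe0] down.
have flatE := web_diagram_flat webE; have [pegs _] := webE.
pose X := [fset e in E | P e]; pose Y := [fset e in E | ~~ P e].
have onX i e : (e \in on_peg X i) = (e \in on_peg E i) && P e.
  by rewrite !inE /= andbAC.
have onY i e : (e \in on_peg Y i) = (e \in on_peg E i) && ~~ P e.
  by rewrite !inE /= andbAC.
have llX : loopless X by move=> e; rewrite !inE => /andP[Ee _]; apply: (flatE.1).
have llY : loopless Y by move=> e; rewrite !inE => /andP[Ee _]; apply: (flatE.1).
(* By [down], everything below an edge of [X] on a peg is in [X]: thus [X] fills the bottom of each
   peg. *)
have hX i e : e \in on_peg X i -> hgt i e <= peg_count X i.
  rewrite onX => /andP[Ee Pe]; rewrite -(flat_rank flatE Ee).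
  apply/fsubset_leq_card/fsubsetP=> f; rewrite in_fset_sep.
  move=> /andP[Ef]; rewrite leq_eqVlt => /orP[/eqP/(flat_hgt_inj flatE Ef Ee) ->|lt_f].
    by rewrite [_ \in _]onX Ee.
  by rewrite [_ \in _]onX Ef; apply: down lt_f Pe.
(* On its peg, [e] lies above every edge of [X], and its rank also counts [e] itself. *)
have hY i e : e \in on_peg Y i -> peg_count X i < hgt i e.
  rewrite onY => /andP[Ee nPe]; rewrite -(flat_rank flatE Ee).
  rewrite (cardfsD1 e) in_fset_sep Ee leqnn add1n ltnS.
  apply/fsubset_leq_card/fsubsetP=> f; rewrite [_ \in _]onX => /andP[Ef Pf].
  rewrite in_fsetD1 in_fset_sep Ef leqNgt; apply/andP; split.
    by apply: contraNneq nPe => <-.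
  by apply/negP=> lt_e; case/negP: nPe; exact: down lt_e Pf.
have cXY i : peg_count E i = peg_count X i + peg_count Y i.
  rewrite !peg_countE -(cardfsID X (on_peg E i)); congr (_ + _); congr #|` _|.
    apply/fsetP=> e; rewrite in_fsetI onX; case Ee : (e \in on_peg E i) => //=.
    by rewrite !inE; move: Ee; rewrite !inE /= => /andP[-> _].
  apply/fsetP=> e; rewrite in_fsetD onY andbC; case Ee : (e \in on_peg E i) => //=.
  by rewrite !inE; move: Ee; rewrite !inE /= => /andP[-> _].
(* Lowering [Y] by the heights that [X] occupies gives the upper summand of a decomposition of
   [E]. *)
pose F := [fset relabel (fun i h => h - peg_count X i) e | e in Y].
have injF : {in Y &, injective (relabel (fun i h => h - peg_count X i))}.
  apply: relabel_inj_in => i h h' /heightsP-/(_ llY)[e /hY + <-].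
  by move=> + /heightsP-/(_ llY)[e' /hY + <-]; lia.
have YF e i : touch i e ->
    hgt i (relabel (fun i h => h - peg_count X i) e) = hgt i e - peg_count X i.
  by move=> te; rewrite hgt_relabel.
have llF : loopless F by move=> e /imfsetP[f /= /llY Yf ->].
have webX : web_diagram n X.
  split=> [e|i _]; first by rewrite !inE => /andP[/pegs].
  apply/fsetP=> h; rewrite in_fset_iota; apply/heightsP/idP => // [[e Xe <-]|hb].
    have := hX _ _ Xe; move: Xe; rewrite onX => /andP[/(flat_bound flatE)]; lia.
  have [|e Ee eh] := @flat_onto _ flatE i h; first by rewrite cXY; lia.
  exists e => //; rewrite onX Ee; apply/negPn/negP=> nPe.
  by have := hY i e; rewrite onY Ee nPe eh => /(_ isT); lia.
have webF : web_diagram n F.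
  split=> [e /imfsetP[f /=]|i _]; first by rewrite !inE => /andP[/pegs ? _] ->.
  have -> : peg_count F i = peg_count Y i by apply: peg_count_relabel.
  apply/fsetP=> h; rewrite in_fset_iota; apply/heightsP/idP => // [[e]|hb].
    rewrite !inE /= => /andP[/imfsetP[f /= Yf ->]]; rewrite touch_relabel => tf <-.
    have onf : f \in on_peg Y i by rewrite !inE tf; move: Yf; rewrite !inE /= => ->.
    rewrite YF //; have := hY _ _ onf; move: onf.
    by rewrite onY => /andP[/(flat_bound flatE)]; rewrite cXY; lia.
  have [|e Ee eh] := @flat_onto _ flatE i (h + peg_count X i); first by rewrite cXY; lia.
  have Ye : e \in on_peg Y i.
    rewrite onY Ee; apply/negP=> Pe; have := hX i e; rewrite onX Ee Pe eh => /(_ isT).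
    by lia.
  have := Ye; rewrite !inE /= => /andP[/andP[Ee' nPe] te].
  exists (relabel (fun i h => h - peg_count X i) e); last by rewrite YF // eh addnK.
  rewrite !inE /= touch_relabel te andbT; apply/imfsetP; exists e => //=.
  by rewrite !inE Ee'.
have sumE : E = wsum X F.
  have back e : e \in Y -> relabel (fun i h => h + peg_count X i)
      (relabel (fun i h => h - peg_count X i) e) = e.
    move=> Ye; rewrite relabel_comp; apply: relabel_id; first exact: llY.
    move=> i te; rewrite subnK //; apply: ltnW; apply: hY.
    by rewrite !inE te; move: Ye; rewrite !inE /= => ->.
  apply/fsetP=> e; rewrite in_fsetU; apply/idP/orP => [Ee|].
    have [Pe|nPe] := boolP (P e); [left|right]; first by rewrite !inE Ee.
    have Ye : e \in Y by rewrite !inE Ee.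
    apply/imfsetP; exists (relabel (fun i h => h - peg_count X i) e); last by rewrite back.
    by apply/imfsetP; exists e.
  case=> [|/imfsetP[f /= /imfsetP[f' /= Yf ->]]]; first by rewrite !inE => /andP[].
  by rewrite back // => ->; move: Yf; rewrite !inE => /andP[].
move=> e Ee; apply/negPn/negP=> nPe; apply: indec; exists X, F.
do 2![split=> //]; split; last split=> //.
  by apply/eqP/fset0Pn; exists e0; rewrite !inE Ee0.
apply/eqP/fset0Pn; exists (relabel (fun i h => h - peg_count X i) e).
by apply/imfsetP; exists e => //=; rewrite !inE Ee.
Qed.

(** * Reconstruction as a stable sort *)

Lemma rank_inj (H : {fset nat}) :
  {in H &, injective (fun h => #|` [fset h' in H | h' <= h]|)}.
Proof.
have lt_rank h h' : h' \in H -> h < h' ->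
    #|` [fset x in H | x <= h]| < #|` [fset x in H | x <= h']|.
  move=> Hh' lth; rewrite [X in _ < X](cardfsD1 h') in_fset_sep Hh' leqnn add1n ltnS.
  apply/fsubset_leq_card/fsubsetP=> x; rewrite in_fsetD1 !in_fset_sep => /andP[-> /=].
  by lia.
move=> h h' Hh Hh' eqr; case: (ltngtP h h') => // /lt_rank; rewrite eqr ltnn.
- by move/(_ Hh').
- by move/(_ Hh).
Qed.

Lemma peg_count_wrel X i : peg_count (wrel X) i = peg_count X i.
Proof. by apply/peg_count_relabel/relabel_inj_in => j; exact: rank_inj. Qed.

Lemma card_imfset_val (K K' : choiceType) (D : {fset K}) (A : {set D}) (g : K -> K') :
  {in A &, forall x y, g (val x) = g (val y) -> x = y} ->
  #|` [fset g (val f) | f in A]| = #|A|.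
Proof.
by move=> inj; rewrite (@card_in_imfset _ _ _ (fun f : D => g (val f))) /= ?cardE.
Qed.

Section StableSort.
Variables (D : {fset edge}) (flatD : flat D).

(** The height of [f] on peg [i] after a stable sort by [c]: the edges not after [f] are counted,
    [f] included, so heights start at 1. *)
Definition stable_hgt (c : D -> nat) (i : nat) (f : D) : nat :=
  #|[set f' : D | touch i (val f') && ~~ lexlt c (fun x => hgt i (val x)) f f']|.

Definition stable_edge (c : D -> nat) (f : D) : edge :=
  (pegx (val f), pegy (val f),
   stable_hgt c (pegx (val f)) f, stable_hgt c (pegy (val f)) f).

Lemma neD (f : D) : pegx (val f) != pegy (val f).
Proof. by apply: flatD.1; exact: valP. Qed.

Lemma on_pegD (f : D) i : touch i (val f) -> val f \in on_peg D i.
Proof. by move=> tf; rewrite !inE tf andbT; exact: valP. Qed.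

Lemma hgtD_inj (f f' : D) i : touch i (val f) -> touch i (val f') ->
  hgt i (val f) = hgt i (val f') -> f = f'.
Proof.
by move=> tf tf' /(flat_hgt_inj flatD (on_pegD tf) (on_pegD tf')) /val_inj.
Qed.

Lemma hgt_stable c i f : touch i (val f) -> hgt i (stable_edge c f) = stable_hgt c i f.
Proof.
rewrite /touch /hgt [pegx (stable_edge _ _)]/(pegx (val f)).
by case: eqP => [<-|_ /= /eqP<-].
Qed.

Lemma stable_hgt_lt c i f f' : touch i (val f) -> touch i (val f') ->
  (stable_hgt c i f < stable_hgt c i f') = lexlt c (fun x => hgt i (val x)) f f'.
Proof.
move=> tf tf'; case: (boolP (lexlt _ _ f f')) => [ltf|nlt].
  apply/proper_card/properP; split.
    by apply/subsetP=> g; rewrite !inE => /andP[-> /=]; move: ltf; rewrite /lexlt /=; lia.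
  by exists f'; rewrite !inE tf' /=; move: ltf; rewrite /lexlt /=; lia.
apply/negbTE; rewrite -leqNgt; apply/subset_leq_card/subsetP=> g; rewrite !inE.
by move=> /andP[-> /=]; move: nlt; rewrite /lexlt /=; lia.
Qed.

Lemma flat_rankD i (f : D) : touch i (val f) ->
  #|[set f' : D | touch i (val f') && (hgt i (val f') <= hgt i (val f))]| =
  hgt i (val f).
Proof.
move=> tf; rewrite -[RHS](flat_rank flatD (on_pegD tf)).
rewrite -(card_imfset_val (g := id)) => [|x y _ _ /val_inj//]; congr #|` _|.
apply/fsetP=> e; rewrite in_fset_sep; apply/imfsetP/andP => /= [[g]|[]].
  by rewrite inE => /andP[tg leg] ->; split=> //; exact: on_pegD.
rewrite !inE /= => /andP[De te] lee; exists [` De] => //=.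
by rewrite inE /= te.
Qed.

Variables (l : nat) (c : {ffun D -> 'I_l}).

Lemma in_colour_class t (e : edge) :
  reflect (exists2 f : D, c f = t & e = val f) (e \in colour_class c t).
Proof.
apply: (iffP (imfsetP _ _ _ _)) => /= -[f]; rewrite ?inE => cf ->; exists f => //.
  exact/eqP.
by rewrite inE cf.
Qed.

Lemma peg_count_class t i :
  peg_count (colour_class c t) i = #|[set f : D | touch i (val f) && (c f == t)]|.
Proof.
rewrite -(card_imfset_val (g := id)) => [|x y _ _ /val_inj//].
rewrite peg_countE; congr #|` _|; apply/fsetP=> e; rewrite in_fset_sep.
apply/andP/imfsetP => /= [[/in_colour_class[f cf ->] tf]|[f]].
  by exists f => //; rewrite inE tf cf eqxx.
by rewrite inE => /andP[tf /eqP cf] ->; split=> //; apply/in_colour_class; exists f.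
Qed.

Lemma rank_class i (f : D) :
  #|` [fset h in heights (colour_class c (c f)) i | h <= hgt i (val f)]| =
  #|[set f' : D | [&& touch i (val f'), c f' == c f & hgt i (val f') <= hgt i (val f)]]|.
Proof.
rewrite -(card_imfset_val (g := hgt i)); last first.
  by move=> x y; rewrite !inE => /and3P[tx _ _] /and3P[ty _ _]; exact: hgtD_inj.
have ll : loopless (colour_class c (c f)).
  by move=> e /in_colour_class[g _ ->]; exact: neD.
congr #|` _|; apply/fsetP=> h; rewrite in_fset_sep.
apply/andP/imfsetP => /= [[/(heightsP _ _ ll)[e]]|[g]].
  rewrite in_fset_sep => /andP[/in_colour_class[g cg ->] tg] <- le_g.
  by exists g => //; rewrite inE tg cg eqxx.
rewrite inE => /and3P[tg /eqP cg leg] ->; split=> //; apply/heightsP => //.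
by exists (val g) => //; rewrite in_fset_sep tg andbT; apply/in_colour_class; exists g.
Qed.

(** The edges not after [f] either have a smaller colour, which gives the shift by earlier classes,
    or share its colour and lie no higher, which gives the rank inside its class. *)
Lemma relabel_class i (f : D) :
  #|` [fset h in heights (colour_class c (c f)) i | h <= hgt i (val f)]| +
  \sum_(u < l | u < c f) peg_count (wrel (colour_class c u)) i =
  stable_hgt (fun x => c x) i f.
Proof.
rewrite rank_class; under eq_bigr do rewrite peg_count_wrel peg_count_class.
have -> : \sum_(u < l | u < c f) #|[set f' : D | touch i (val f') && (c f' == u)]| =
          #|[set f' : D | touch i (val f') && (c f' < c f)]|.
  rewrite -sum1dep_card (partition_big c (fun u => u < c f)) /=; last first.
    by move=> g /andP[].
  apply: eq_bigr => u ltu; rewrite -sum1dep_card; apply: eq_bigl => g.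
  by case: eqP => [->|_]; rewrite ?andbF // ltu !andbT.
rewrite /stable_hgt -cardsUI -[RHS]addn0; congr (_ + _).
  apply: eq_card => g; rewrite !inE; case: (touch _ _) => //=.
  by rewrite -val_eqE /lexlt /=; lia.
apply/eqP; rewrite cards_eq0; apply/eqP/setP=> g; rewrite !inE.
by case: (touch _ _) => //=; rewrite -val_eqE /=; lia.
Qed.

Lemma in_reconstruct (e : edge) :
  e \in reconstruct c <-> exists f : D, e = stable_edge (fun x => c x) f.
Proof.
have stE (f : D) : relabel (fun i h =>
      h + \sum_(u < l | u < c f) peg_count (wrel (colour_class c u)) i)
    (relabel (fun i h =>
       #|` [fset h' in heights (colour_class c (c f)) i | h' <= h]|) (val f)) =
    stable_edge (fun x => c x) f.
  apply: edge_eq => // [|i ti]; first exact: neD.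
  rewrite relabel_comp hgt_relabel // hgt_stable //; exact: relabel_class.
split.
  move=> /in_big_wsum[t [g /imfsetP[e' /= /in_colour_class[f cf ->] ->] ->]].
  by exists f; rewrite -stE cf.
move=> [f ->]; apply/in_big_wsum; exists (c f).
exists (relabel (fun i h =>
       #|` [fset h' in heights (colour_class c (c f)) i | h' <= h]|) (val f)).
  by apply/imfsetP; exists (val f) => //=; apply/in_colour_class; exists f.
by rewrite stE.
Qed.

(** Not an order: two edges may be related both ways, on different pegs. *)
Definition peg_lt (f f' : D) : Prop :=
  exists i, [/\ touch i (val f), touch i (val f') & hgt i (val f) < hgt i (val f')].

(** Sorting by a colour that already increases along every peg moves nothing. *)
Lemma reconstruct_monotone :
  (forall f f', peg_lt f f' -> c f <= c f') -> reconstruct c = D.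
Proof.
move=> mon; have stE f : stable_edge (fun x => c x) f = val f.
  apply/esym/edge_eq => // [|i ti]; first exact: neD.
  rewrite hgt_stable // -[LHS]flat_rankD //; apply: eq_card => g; rewrite !inE.
  case tg : (touch i (val g)) => //=; rewrite /lexlt /=.
  case: (ltngtP (hgt i (val g)) (hgt i (val f))) => [ltg|ltg|eqg].
  - have : c g <= c f by apply: mon; exists i.
    by lia.
  - have : c f <= c g by apply: mon; exists i.
    by lia.
  by rewrite (hgtD_inj tg ti eqg); lia.
apply/fsetP=> e; apply/idP/idP => [/in_reconstruct[f ->]|De].
  by rewrite stE; exact: valP.
by apply/in_reconstruct; exists [` De]; rewrite stE.
Qed.

End StableSort.

(** * The components of a sum of indecomposables *)

Section Components.
Variables (n k : nat) (D : {fset edge}) (E : 'I_k -> {fset edge}).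
Hypotheses (webE : forall i, web_diagram n (E i)).
Hypotheses (indecE : forall i, indecomposable n (E i)).
Hypothesis sumE : D = \wsum_(i < k) E i.

Let flatE i : flat (E i) := web_diagram_flat (webE i).

Definition offset (i : 'I_k) (p : nat) : nat := \sum_(j < k | j < i) peg_count (E j) p.

Definition lift_edge (i : 'I_k) : edge -> edge := relabel (fun p h => h + offset i p).

Lemma in_summand i e :
  reflect (exists2 f, f \in E i & e = lift_edge i f) (e \in summand E i).
Proof.
have shiftE f : relabel (fun p h => h + peg_count (\wsum_(j < k | j < i) E j) p) f =
    lift_edge i f.
  by apply: eq_relabel => p h; rewrite (big_wsum_flat _ _ flatE).2.
apply: (iffP (imfsetP _ _ _ _)) => /= -[f Ef ->]; exists f => //.
Qed.

Lemma flatD : flat D.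
Proof. by rewrite sumE; exact: (big_wsum_flat _ _ flatE).1. Qed.

Lemma offset_lt (i j : 'I_k) p : i < j -> offset i p + peg_count (E i) p <= offset j p.
Proof.
move=> ltij; rewrite [X in _ <= X](bigD1 i) //= addnC leq_add2l.
rewrite /offset big_mkcond [X in _ <= X]big_mkcond; apply: leq_sum => u _.
by case: ifP => // ltu; case: ifP => //; rewrite -val_eqE /=; lia.
Qed.

Lemma touch_lift i e p : touch p (lift_edge i e) = touch p e. Proof. by []. Qed.

Lemma hgt_lift i e p : touch p e -> hgt p (lift_edge i e) = hgt p e + offset i p.
Proof. by move=> te; rewrite hgt_relabel. Qed.

Lemma summand_bound i e p : e \in summand E i -> touch p e ->
  offset i p < hgt p e <= offset i p + peg_count (E i) p.
Proof.
move=> /in_summand[f Ef ->]; rewrite touch_lift => tf; rewrite hgt_lift //.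
have onf : f \in on_peg (E i) p by rewrite !inE Ef.
by have := flat_bound (flatE i) onf; lia.
Qed.

(** On each peg the summands occupy successive blocks of heights, in the order of their indices. *)
Lemma summand_le i j e e' p : e \in summand E i -> e' \in summand E j ->
  touch p e -> touch p e' -> hgt p e <= hgt p e' -> i <= j.
Proof.
move=> Se Se' te te' leh; rewrite leqNgt; apply/negP => /(offset_lt p).
by have := summand_bound Se te; have := summand_bound Se' te'; lia.
Qed.

Lemma summand_uniq i j e : e \in summand E i -> e \in summand E j -> i = j.
Proof.
move=> Si Sj; apply/val_inj/eqP; rewrite eqn_leq.
by rewrite !(@summand_le _ _ e e (pegx e)) ?touchx.
Qed.

Lemma in_sum_summand e : e \in D <-> exists i, e \in summand E i.
Proof.
rewrite sumE; split=> [/in_big_wsum[i [f Ef ->]]|[i /in_summand[f Ef ->]]].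
  by exists i; apply/in_summand; exists f.
by apply/in_big_wsum; exists i, f.
Qed.

Lemma component_exists : exists idx : D -> 'I_k,
  forall f j, (val f \in summand E j) = (idx f == j).
Proof.
have /fin_all_exists[idx idxP] (f : D) : exists i, val f \in summand E i.
  by apply/in_sum_summand; exact: valP.
by exists idx => f j; apply/idP/eqP => [/(summand_uniq (idxP f))|<-].
Qed.

Variable idx : D -> 'I_k.
Hypothesis idxP : forall f j, (val f \in summand E j) = (idx f == j).

Lemma idx_lift i e : e \in E i -> exists2 f : D, val f = lift_edge i e & idx f = i.
Proof.
move=> Ee; have Se : lift_edge i e \in summand E i by apply/in_summand; exists e.
have De : lift_edge i e \in D by apply/in_sum_summand; exists i.
by exists [` De] => //; apply/eqP; rewrite -idxP.
Qed.

Lemma idx_unlift f : exists2 e, e \in E (idx f) & val f = lift_edge (idx f) e.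
Proof. by apply/in_summand; rewrite idxP. Qed.

Lemma idx_surj i : exists f, idx f = i.
Proof.
have [/eqP/fset0Pn[e Ee] _] := indecE i; have [f _ fi] := idx_lift Ee.
by exists f.
Qed.

Lemma idx_le f f' : peg_lt f f' -> idx f <= idx f'.
Proof.
move=> [p [tf tf' lth]]; apply: (summand_le _ _ tf tf' (ltnW lth)); by rewrite idxP.
Qed.

(** The edges with value at most [v f'] are closed under going down, so by [indecomposable_ind] they
    fill the component; exchanging [f] and [f'] gives equality. *)
Lemma component_const (v : D -> nat) (j : 'I_k) :
  (forall f f', idx f = j -> idx f' = j -> peg_lt f f' -> v f <= v f') ->
  forall f f', idx f = j -> idx f' = j -> v f = v f'.
Proof.
move=> mon; suff le_v f f' : idx f = j -> idx f' = j -> v f <= v f'.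
  by move=> f f' fj f'j; apply/eqP; rewrite eqn_leq !le_v.
move=> fj f'j.
(* The predicate lives on the unshifted edges of [E j], where indecomposability applies. *)
pose P e := [exists g : D, [&& val g == lift_edge j e, idx g == j & v g <= v f']].
have [e Ee fe] := idx_unlift f; have [e' Ee' fe'] := idx_unlift f'.
rewrite fj f'j in Ee fe Ee' fe'.
have : P e.
  apply: (indecomposable_ind (webE j) (indecE j)) Ee; last first.
    move=> i e1 e2; rewrite !in_fset_sep => /andP[E1 t1] /andP[E2 t2] lth.
    move=> /existsP[g2 /and3P[/eqP g2e /eqP g2j leg2]].
    have [g1 g1e g1j] := idx_lift E1; apply/existsP; exists g1.
    rewrite g1e g1j !eqxx /=; apply: leq_trans leg2; apply: mon => //; exists i.
    by rewrite g1e g2e !touch_lift !hgt_lift // ltn_add2r.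
  by exists e' => //; apply/existsP; exists f'; rewrite fe' f'j !eqxx leqnn.
move=> /existsP[g /and3P[/eqP ge _ leg]].
by rewrite (_ : f = g) //; apply/val_inj; rewrite ge.
Qed.

(** The height of [f] inside its own summand, read off from the order of [D] on the peg. *)
Definition component_rank (p : nat) (f : D) : nat :=
  #|[set f' : D | [&& idx f' == idx f, touch p (val f') &
                      hgt p (val f') <= hgt p (val f)]]|.

Lemma component_rankE p f : touch p (val f) ->
  hgt p (val f) = component_rank p f + offset (idx f) p.
Proof.
move=> tf; have [e Ee fe] := idx_unlift f.
have te : touch p e by rewrite -(touch_lift (idx f)) -fe.
have one : e \in on_peg (E (idx f)) p by rewrite in_fset_sep Ee.
rewrite fe hgt_lift // -{1}(flat_rank (flatE _) one); congr (_ + _).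
rewrite /component_rank -(card_imfset_val (g := id)) => [|x y _ _ /val_inj//].
have inj : injective (lift_edge (idx f)) := @relabel_shift_inj _.
rewrite -[LHS](eqP (introT (card_in_imfsetP (lift_edge (idx f)) _) (in2W inj))).
congr #|` _|.
apply/fsetP=> e1; apply/imfsetP/imfsetP => /= -[].
  move=> e2; rewrite !in_fset_sep => /andP[/andP[E2 t2] le2] ->.
  have [g ge gf] := idx_lift E2; exists g => //.
  by rewrite inE gf eqxx ge fe touch_lift t2 !hgt_lift // leq_add2r.
move=> g; rewrite inE => /and3P[/eqP gf tg leg] ->.
have [e2 E2 ge] := idx_unlift g; rewrite gf in E2 ge.
exists e2 => //; move: tg leg; rewrite ge fe touch_lift => t2.
by rewrite !hgt_lift // leq_add2r => le2; rewrite !in_fset_sep E2 t2.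
Qed.

(** Expresses [E i] through pegs and [component_rank] alone, so that two summands can be compared
    edge by edge. *)
Lemma in_component i e : e \in E i <-> exists2 f, idx f = i &
  [/\ pegx e = pegx (val f), pegy e = pegy (val f) &
      forall p, touch p e -> hgt p e = component_rank p f].
Proof.
split=> [Ee|[f fi [ex ey eh]]].
  have [f fe fi] := idx_lift Ee; exists f => //; rewrite fe; split=> // p te.
  have := @component_rankE p f; rewrite fe touch_lift hgt_lift // fi => /(_ te).
  exact: addIn.
have [e' Ee' fe] := idx_unlift f; rewrite fi in Ee' fe.
rewrite (_ : e = e') //; apply/edge_eq.
- by rewrite ex ey; exact: (neD flatD).
- by rewrite ex fe.
- by rewrite ey fe.
move=> p te; rewrite eh //.
have te' : touch p (val f) by move: te; rewrite /touch ex ey.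
have := component_rankE te'; rewrite {1}fe hgt_lift ?fi => [/addIn->//|].
by move: te'; rewrite fe.
Qed.

(** * Colourings that reconstruct [D] *)

Section Fixed.
Variables (l : nat) (c : {ffun D -> 'I_l}).
Hypothesis injE : injective E.
Hypothesis fixD : reconstruct c = D.

(* The edge permutation induced by the reconstruction permutes the components:
   the colour is constant on the preimage of a component, hence so is the index. *)
Lemma reconstruct_fixed_monotone f f' : peg_lt f f' -> c f <= c f'.
Proof.
have flD := flatD; pose cn (x : D) : nat := c x.
(* [phi] sends an edge to its copy in the reconstruction, which is again an edge of [D]. It is onto,
   hence bijective by finiteness, with inverse [psi]. *)
have /fin_all_exists[phi phiE] (g : D) : exists h : D, val h = stable_edge cn g.
  have De : stable_edge cn g \in D.
    by rewrite -[X in _ \in X]fixD; apply/in_reconstruct => //; exists g.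
  by exists [` De].
have /fin_all_exists[psi psiK] (h : D) : exists g, phi g = h.
  have : val h \in reconstruct c by rewrite fixD; exact: valP.
  by move=> /(in_reconstruct flD)[g hg]; exists g; apply/val_inj; rewrite phiE.
have phiK : cancel phi psi by apply: canF_sym.
have phit p g : touch p (val (phi g)) = touch p (val g) by rewrite phiE.
have phih p g : touch p (val g) -> hgt p (val (phi g)) = stable_hgt cn p g.
  by move=> tg; rewrite phiE hgt_stable.
have psit p h : touch p (val (psi h)) = touch p (val h) by rewrite -phit psiK.
have lt_psi p h h' : touch p (val h) -> touch p (val h') -> hgt p (val h) < hgt p (val h') ->
    lexlt cn (fun x => hgt p (val x)) (psi h) (psi h').
  move=> th th'; rewrite -{1}(psiK h) -{1}(psiK h') !phih ?psit //.
  by rewrite stable_hgt_lt // psit.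
have colour_psi h h' : idx h = idx h' -> cn (psi h) = cn (psi h').
  move=> eqi; apply: (@component_const (fun x => cn (psi x)) (idx h')) => //.
  by move=> g g' _ _ [p [tg tg' /(lt_psi _ _ _ tg tg')]]; rewrite /lexlt /=; lia.
(* Inside the preimage of a component all colours agree, so the sort there follows the heights of
   [D], along which the index weakly increases. *)
have idx_psi h h' : idx h = idx h' -> idx (psi h) = idx (psi h').
  move=> eqi; apply/val_inj.
  apply: (@component_const (fun x => val (idx (psi x))) (idx h')) => //.
  move=> g g' gi gi' [p [tg tg' /(lt_psi _ _ _ tg tg')]].
  have eqc : cn (psi g) = cn (psi g') by apply: colour_psi; rewrite gi.
  rewrite /lexlt eqc eqxx ltnn /= => lth; apply: idx_le; exists p.
  by rewrite !psit.
have /fin_all_exists[rep repP] := idx_surj.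
(* The maps induced on component indices by [phi] and [psi]. That [sig] is well defined is
   [idx_psi]; finiteness then makes [tau] its two-sided inverse. *)
pose tau i := idx (phi (rep i)); pose sig j := idx (psi (rep j)).
have sigE g : idx g = sig (idx (phi g)).
  by rewrite -{1}(phiK g); apply: idx_psi; rewrite repP.
have tauK : cancel tau sig by move=> i; rewrite /tau -sigE repP.
have sigK : cancel sig tau by apply: canF_sym.
have idx_phi g : idx (phi g) = tau (idx g) by rewrite (sigE g) sigK.
have colour_phi g g' : idx g = idx g' -> cn g = cn g'.
  move=> eqi; rewrite -(phiK g) -(phiK g'); apply: colour_psi.
  by rewrite !idx_phi eqi.
(* A component has a single colour, so the sort keeps the order inside it. *)
have rank_phi p g : touch p (val g) -> component_rank p (phi g) = component_rank p g.
  move=> tg; rewrite /component_rank -[RHS](card_imset _ (can_inj phiK)).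
  apply: eq_card => h; rewrite !inE -(psiK h) mem_imset ?inE; last exact: can_inj phiK.
  rewrite !idx_phi (can_eq tauK) phit; case: eqP => //= eqi.
  case tq : (touch _ _) => //=; rewrite !phih // leqNgt stable_hgt_lt //.
  by rewrite /lexlt (colour_phi _ _ eqi) eqxx ltnn /= -leqNgt.
(* Shapes are preserved, so [E (tau i)] equals [E i], and distinctness of the summands applies. *)
have tau_id i : tau i = i.
  apply: injE; apply/fsetP=> e; apply/idP/idP => /in_component.
    move=> [h hi [ex ey eh]]; apply/in_component; exists (psi h).
      by apply: (can_inj tauK); rewrite -idx_phi psiK.
    have exy : pegx (val h) = pegx (val (psi h)) /\ pegy (val h) = pegy (val (psi h)).
      by rewrite -{1 3}(psiK h) phiE.
    rewrite -exy.1 -exy.2; split=> // p te; rewrite eh // -{1}(psiK h) rank_phi //.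
    by move: te; rewrite /touch ex ey exy.1 exy.2.
  move=> [g gi [ex ey eh]]; apply/in_component; exists (phi g).
    by rewrite idx_phi gi.
  rewrite !phiE; split=> // p te; rewrite eh // rank_phi //.
  by move: te; rewrite /touch ex ey.
(* Component, offset and rank are all kept, so the sort fixes every height; the order of heights is
   then the order by colour first. *)
have phi_hgt p g : touch p (val g) -> stable_hgt cn p g = hgt p (val g).
  move=> tg; rewrite -phih // (component_rankE tg) [LHS]component_rankE ?phit //.
  by rewrite rank_phi // idx_phi tau_id.
move=> [p [tf tf']]; rewrite -!phi_hgt // stable_hgt_lt // /lexlt /cn; lia.
Qed.

End Fixed.

(** * Colourings as maps on the decomposition poset *)

Lemma belowP i j : reflect (exists f f', [/\ idx f = i, idx f' = j, peg_lt f f' & i < j])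
  (below E i j).
Proof.
apply: (iffP andP) => [[ltij /existsP[e /existsP[e' /hasP[[p h] pe /hasP[[p' h'] pe']]]]]|].
  have lleq q (x : summand E q) : exists2 f : D, val f = val x & idx f = q.
    have Dx : val x \in D by apply/in_sum_summand; exists q; exact: valP.
    by exists [` Dx] => //; apply/eqP; rewrite -idxP; exact: (valP x).
  have [f fe fi] := lleq _ e; have [f' fe' fj] := lleq _ e'.
  move=> /= /andP[/eqP pp' lth]; exists f, f'; split=> //; exists p.
  move: pe pe'; rewrite -fe -fe' !endpointsP ?(neD flatD) // -pp'.
  by move=> /andP[-> /eqP->] /andP[-> /eqP->].
move=> [f [f' [fi fj [p [tf tf' lth]] ltij]]]; split=> //.
have Sf : val f \in summand E i by rewrite idxP fi.
have Sf' : val f' \in summand E j by rewrite idxP fj.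
apply/existsP; exists [` Sf]; apply/existsP; exists [` Sf'].
apply/hasP; exists (p, hgt p (val f)); first by rewrite endpointsP ?(neD flatD) // tf /=.
apply/hasP; exists (p, hgt p (val f')); first by rewrite endpointsP ?(neD flatD) // tf' /=.
by rewrite /= eqxx.
Qed.

Lemma decomp_le_leq i j : decomp_le E i j -> i <= j.
Proof.
move=> /connectP[s + ->]; elim: s i => //= x s IH i /andP[/andP[ltix _] /IH].
exact/leq_trans/ltnW.
Qed.

(** The colourings that reconstruct [D] are constant on components and are exactly the pullbacks
    along [idx] of the order-preserving surjections. *)
Lemma fcount_monotone_maps l : injective E ->
  fcount D D l = #|monotone_maps l (decomp_le E)|.
Proof.
move=> injE; have /fin_all_exists[rep repP] := idx_surj.
pose pull (g : {ffun 'I_k -> 'I_l}) := [ffun f => g (idx f)] : {ffun D -> 'I_l}.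
have pull_inj : injective pull.
  by move=> g g' /ffunP eqp; apply/ffunP=> i; have := eqp (rep i); rewrite !ffunE repP.
(* Monotonicity need only be checked on the generating relation [below]. *)
have monD (g : {ffun 'I_k -> 'I_l}) i j : (forall i j, below E i j -> g i <= g j) ->
    decomp_le E i j -> g i <= g j.
  move=> mon /connectP[s + ->]; elim: s i => //= x s IH i /andP[/mon lei /IH].
  exact: leq_trans.
rewrite -(card_imset _ pull_inj); apply: eq_card => c; rewrite inE.
apply/andP/imsetP => [[/forallP cs /eqP fixc]|[g]].
  have mon := reconstruct_fixed_monotone injE fixc.
  have cidx f f' : idx f = idx f' -> c f = c f'.
    move=> eqi; apply/val_inj; apply: (@component_const (fun x => val (c x)) (idx f')) => //.
    by move=> h h' _ _; exact: mon.
  exists [ffun i => c (rep i)]; last by apply/ffunP=> f; rewrite !ffunE; apply: cidx; rewrite repP.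
  rewrite inE; apply/andP; split.
    apply/forallP=> t; have /existsP[f /eqP cf] := cs t.
    by apply/existsP; exists (idx f); rewrite ffunE -cf; apply/eqP/cidx; rewrite repP.
  apply/forallP=> i; apply/forallP=> j; apply/implyP; apply: monD => {}i {}j.
  move=> /belowP[f [f' [fi fj lt_f _]]]; rewrite !ffunE.
  by rewrite (cidx (rep i) f) ?repP // (cidx (rep j) f') ?repP //; exact: mon.
rewrite inE => /andP[/forallP gs /forallP mon] ->; split.
  apply/forallP=> t; have /existsP[i /eqP gi] := gs t.
  by apply/existsP; exists (rep i); rewrite ffunE repP gi.
apply/eqP; apply: (reconstruct_monotone flatD) => f f' lt_f; rewrite !ffunE.
have := idx_le lt_f; rewrite leq_eqVlt => /orP[/eqP/val_inj->//|lti].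
move: (mon (idx f)) => /forallP/(_ (idx f'))/implyP; apply; apply: connect1.
by apply/belowP; exists f, f'.
Qed.

(** Ensures that the sums in [webM] and [webR], cut off at the number of edges, reach every chain
    length up to [k]. *)
Lemma card_components : k <= #|` D|.
Proof.
have /fin_all_exists[rep repP] := idx_surj.
rewrite cardfE -[X in X <= _]card_ord; exact: (leq_card rep (can_inj repP)).
Qed.

End Components.

(** * From the count of colourings to the two formulas *)

Local Open Scope fset_scope.
Local Open Scope ring_scope.

Theorem theorem3p4 (n k : nat) (D : {fset edge}) (E : 'I_k -> {fset edge})
    (hD : web_diagram n D)
    (hD0 : D <> fset0)
    (hE : forall i, web_diagram n (E i))
    (hEind : forall i, indecomposable n (E i))
    (hsum : D = \wsum_(i < k) E i)
    (hdist : injective E) :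
  webM (in_own_world D) (in_own_world D) =
    \sum_(s : 'S_k | linear_ext E s)
      'X^(1 + des s) * (1 + 'X) ^+ (k - 1 - des s)
  /\
  webR (in_own_world D) (in_own_world D) =
    \sum_(s : 'S_k | linear_ext E s)
      (-1) ^+ des s / (k%:R * 'C(k - 1, des s)%:R).
Proof.
have [idx idxP] := component_exists hE hsum.
case: k E hE hEind hsum hdist idx idxP => [|m] E hE hEind hsum hdist idx idxP.
  (* With no summand [D] would be empty. *)
  by case: hD0; rewrite hsum big_ord0.
have ltmL : (m < #|` D|)%N := card_components hE hEind hsum idxP.
have fE l := fcount_monotone_maps hE hEind hsum idxP l hdist.
rewrite /webM /webR /=; split.
  under eq_bigr do rewrite scaler_nat fE.
  rewrite sum_monotone_maps //; last exact: decomp_le_leq.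
  by apply: eq_bigr => s _; rewrite sum_polyX_bin subn1.
under eq_bigr do rewrite mulr_natr fE.
rewrite (sum_monotone_maps (fun l => (-1) ^+ (l - 1) / l%:R : rat)) //; last exact: decomp_le_leq.
apply: eq_bigr => s _; rewrite sum_alternating_inv_bin subn1 subnKC //.
exact: des_le.
Qed.
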